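(* There are infinitely many odd strongly pseudoperfect numbers.
   Context: A positive integer $n$ is strongly pseudoperfect if there is a subset $S$ of the positive divisors of $n$ (with $1$ and $n$ themselves allowed) such that $d\in S$ if and only if $n/d\in S$ for every positive divisor $d$ of $n$, and $\sum_{d\in S} d = 2n$. *)

(* Defs.v *)
From mathcomp Require Import all_boot finmap.
From mathcomp Require Import classical_sets cardinality.

Set Implicit Arguments.
Unset Strict Implicit.
Unset Printing Implicit Defensive.

(* The division n %/ d is exact, since it is only used for d %| n. *)
Definition strongly_pseudoperfect (n : nat) : Prop :=
  0 < n /\
  exists S : {fset nat},
    [/\ {subset S <= divisors n},
        forall d : nat, d %| n -> (d \in S <-> n %/ d \in S)
      & \sum_(d <- S) d = 2 * n].

(* Main.v *)
Require Import Defs.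
From mathcomp Require Import all_boot classical_sets cardinality.
From mathcomp Require Import finmap zify.

(** If [S] witnesses that [n] is strongly pseudoperfect and [1 \in S] (hence
    [n \in S]), then [(S \ {n}) U n (S \ {1})] is symmetric under
    [d |-> n ^ 2 / d], contains [1], and has sum [n + n (2 n - 1) = 2 n ^ 2];
    the union is disjoint because its two parts lie below and above [n].
    So such numbers are closed under squaring, and 105 ^ 2 is an odd one. *)

Local Open Scope classical_set_scope.

(** One-way closure under [d |-> n %/ d] already gives the equivalence, since this map is an
    involution on the divisors of [n]. Requiring [1 \in s] lets squaring be iterated. *)
Definition witness (n : nat) (s : seq nat) : Prop :=
  [/\ uniq s, 1 \in s,
      {in s, forall d, (d %| n) && (n %/ d \in s)}
    & \sum_(d <- s) d = 2 * n].

Lemma witness_strongly_pseudoperfect (n : nat) (s : seq nat) :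
  0 < n -> witness n s -> strongly_pseudoperfect n.
Proof.
move=> n_gt0 [s_uniq _ s_sym s_sum]; split=> //.
exists [fset x in s]%fset; split=> [d|d d_dvd|].
- by rewrite inE /= -dvdn_divisors // => /s_sym /andP[].
- rewrite !inE /=; split=> [/s_sym /andP[] // | /s_sym /andP[_]].
  by rewrite divnA // mulKn.
- rewrite -s_sum; apply: perm_big; apply: uniq_perm => // x.
  by rewrite inE.
Qed.

Lemma witness_square (n : nat) (s : seq nat) :
  1 < n -> witness n s ->
  witness (n * n) (rem n s ++ map (muln n) (rem 1 s)).
Proof.
move=> n_gt1 [s_uniq s1 s_sym s_sum].
have n_gt0 : 0 < n by exact: ltnW.
have sn : n \in s by have /andP[_] := s_sym _ s1; rewrite divn1.
split.
- rewrite cat_uniq rem_uniq // map_inj_uniq ?rem_uniq ?andbT //=; last first.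
    by move=> x y /eqP; rewrite eqn_pmul2l // => /eqP.
  (* A common element [n * d] would divide [n], forcing [d <= 1]; but [d] is positive and not
     [1]. *)
  apply/hasPn => _ /mapP[d + ->]; rewrite !mem_rem_uniq // !inE.
  move=> /andP[d_neq1 ds]; apply/negP => /andP[nd_neqn /s_sym /andP[]].
  move=> /dvdn_leq - /(_ n_gt0); rewrite -{2}[n]muln1 leq_pmul2l //.
  have /andP[/dvdn_gt0 - /(_ n_gt0)] := s_sym _ ds; lia.
- by rewrite mem_cat mem_rem_uniq // !inE s1; case: eqP n_gt1 => // <-.
- move=> d; rewrite mem_cat mem_rem_uniq // inE.
  (* Complementation swaps the two parts: [d] goes to [n * (n %/ d)], and [n * e] to [n %/ e]. *)
  case/orP=> [/andP[d_neqn ds]|/mapP[e + ->]].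
    have /andP[d_dvd nds] := s_sym _ ds.
    rewrite dvdn_mulr //= mem_cat -muln_divA //.
    apply/orP; right; apply: map_f; rewrite mem_rem_uniq // !inE nds andbT.
    by rewrite eq_sym eqn_div ?(dvdn_gt0 n_gt0 d_dvd) // mul1n.
  rewrite mem_rem_uniq // inE => /andP[e_neq1 es].
  have /andP[e_dvd nes] := s_sym _ es.
  rewrite dvdn_pmul2l // e_dvd divnMl // mem_cat mem_rem_uniq // !inE nes.
  by rewrite eq_sym eqn_div ?(dvdn_gt0 n_gt0 e_dvd) // -{2}[n]muln1 eqn_pmul2l ?e_neq1.
- have := s_sum; rewrite (big_rem n) //= => sum_n.
  have := s_sum; rewrite (big_rem 1) //= => sum_1.
  rewrite big_cat big_map -big_distrr /=; nia.
Qed.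

Lemma witness_105_square :
  exists s, witness (105 * 105) s.
Proof.
(* All divisors of [105 * 105] except 25, 35, 105, 315 and 441: these are closed under
   complementation and add up to the excess 22971 - 22050 = 921 of the divisor sum over twice the
   number. *)
exists [:: 1; 3; 5; 7; 9; 15; 21; 45; 49; 63; 75; 147; 175; 225; 245;
           525; 735; 25 * 49; 35 * 45; 45 * 49; 75 * 49; 105 * 105].
split; [by vm_compute | by [] | apply/allP; by vm_compute |].
by rewrite !big_cons big_nil; lia.
Qed.

(** Squaring preserves oddness and at least doubles any [n > 1], so iterating it from [105 * 105]
    passes every bound. *)
Lemma unbounded_witness (m : nat) :
  exists n, [/\ m < n, 1 < n, odd n & exists s, witness n s].
Proof.
elim: m => [|m [n [m_lt n_gt1 n_odd [s sP]]]].
  exists (105 * 105); split; [lia | lia | by rewrite oddM |].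
  exact: witness_105_square.
exists (n * n); split; [nia | nia | by rewrite oddM n_odd |].
by eexists; exact: witness_square sP.
Qed.

Theorem corollary7 :
  infinite_set [set n : nat | odd n /\ strongly_pseudoperfect n].
Proof.
move=> /finite_fsetP[X XE].
have [n [n_gt n_gt1 n_odd [s sP]]] := unbounded_witness (\max_(x <- X) x).
have nX : n \in X.
  have : [set n | odd n /\ strongly_pseudoperfect n] n.
    by split=> //; apply: witness_strongly_pseudoperfect sP; exact: ltnW.
  by rewrite XE.
by move: n_gt; rewrite ltnNge (leq_bigmax_seq (F := id)).
Qed.
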